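(* Let $G$ be a graph with at least one edge. The following statements are equivalent: (i) $\alpha_{\rm es}(G)=0$; (ii) every vertex $x\in V(G)$ has a neighbor $y\in N(x)$ such that $N[y]\subseteq N[x]$; (iii) every vertex of $G$ is a universal vertex, or a twin, or a support of a twin.
   Context: All graphs are finite and simple. $N(v)$ and $N[v]=N(v)\cup\{v\}$ are the open and closed neighborhoods of $v$; for $B\subseteq V(G)$, $N[B]=\bigcup_{b\in B}N[b]$ and $N(B)=N[B]- B$. A set $B\subseteq V(G)$ is an externally supported independence set (ESI-set) if $B$ is independent and every $v\in N(B)$ has a neighbor in $V(G)- N[B]$ (the empty set is an ESI-set); $\alpha_{\rm es}(G)$ is the maximum cardinality of an ESI-set of $G$. A vertex is universal if its degree is $|V(G)|-1$. Distinct vertices $u,v$ are twins if $N[u]=N[v]$; a vertex $u$ is called a twin if there is some $v\neq u$ such that $u$ and $v$ are twins. A vertex $w$ is a support of a twin if there is a twin $u$ with $N[u]\subsetneq N[w]$. *)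

(* Defs.v *)
(* A finite simple graph with vertex type T : finType is given by
   its adjacency relation e : rel T, assumed symmetric and irreflexive in the
   theorem. *)
From HB Require Import structures.
From mathcomp Require Import all_boot.

Set Implicit Arguments.
Unset Strict Implicit.
Unset Printing Implicit Defensive.

Section Graph.

Variables (T : finType) (e : rel T).
Implicit Types (u v w : T) (B : {set T}).

Definition opn v : {set T} := [set w | e v w].

Definition cln v : {set T} := v |: opn v.

Definition set_cln B : {set T} := \bigcup_(b in B) cln b.

(* This is N[B] - B, not the union of the open neighborhoods. *)
Definition set_opn B : {set T} := set_cln B :\: B.

Definition independent B : bool :=
  [forall u in B, forall v in B, ~~ e u v].

Definition esi B : bool :=
  independent B &&
  [forall v in set_opn B, exists w in ~: set_cln B, e v w].

(* The maximum is over a nonempty family, since set0 is an ESI-set. *)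
Definition alpha_es : nat := \max_(B : {set T} | esi B) #|B|.

Definition universal v : Prop := #|opn v| = #|T|.-1.

Definition twins u v : Prop := u <> v /\ cln u = cln v.

Definition is_twin u : Prop := exists v, twins u v.

Definition twin_support w : Prop :=
  exists u, is_twin u /\ cln u \proper cln w.

End Graph.

(* Main.v *)
(* The singleton {x} is an ESI-set exactly when no neighbor y of x satisfies
   N[y] \subset N[x]; conversely such a y, for any x in B, has no neighbor
   outside N[B].  For (ii) -> (iii), iterate x |-> y: the closed neighborhoods
   shrink, so the process reaches two adjacent vertices with the same closed
   neighborhood. *)
Require Import Defs.
From mathcomp Require Import all_boot.

Set Implicit Arguments.
Unset Strict Implicit.
Unset Printing Implicit Defensive.

Section Domination.

Variables (T : finType) (e : rel T).
Hypothesis e_irr : irreflexive e.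
Implicit Types (u v w x y : T) (B : {set T}).

Lemma in_cln x y : (y \in cln e x) = (y == x) || e x y.
Proof. by rewrite !inE. Qed.

Lemma cln_refl x : x \in cln e x.
Proof. by rewrite in_cln eqxx. Qed.

Lemma in_opn_cln x y : x <> y -> y \in cln e x -> y \in opn e x.
Proof. by rewrite in_cln inE => /eqP; rewrite eq_sym => /negPf ->. Qed.

Lemma opn_neq x y : y \in opn e x -> x <> y.
Proof. by rewrite inE => exy eq_xy; rewrite eq_xy e_irr in exy. Qed.

Lemma set_cln1 x : set_cln e [set x] = cln e x.
Proof. exact: big_set1. Qed.

(** Since [y] itself lies in N[x] when it is adjacent to [x], a witness against N[y] being contained
    in N[x] must be a neighbor of [y] outside N[x], which is exactly the external support of [y]. *)
Lemma esi1 x :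
  esi e [set x] =
  [forall y in opn e x, ~~ (cln e y \subset cln e x)].
Proof.
have -> : esi e [set x] = [forall v in set_opn e [set x],
                            exists w in ~: set_cln e [set x], e v w].
  rewrite /esi; case: (boolP (independent _ _)) => // /negP[].
  by apply/forall_inP => u /set1P->; apply/forall_inP => v /set1P->;
     rewrite e_irr.
apply: eq_forallb => y; rewrite /set_opn set_cln1 inE in_set1 in_cln.
rewrite [y \in opn e x]inE.
case: eqVneq => [->|/= _]; first by rewrite e_irr.
case exy: (e x y) => //=; apply/exists_inP/subsetPn => [[w]|[w]].
  by rewrite inE => wx eyw; exists w; rewrite // in_cln eyw orbT.
rewrite in_cln => /orP[/eqP->|eyw wx]; first by rewrite in_cln exy orbT.
by exists w; rewrite ?in_setC.
Qed.

(** If [x] were in [B], independence would put [y] in N(B), yet all neighbors of [y] lie in N[x],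
    hence in N[B], so [y] would have no external support. *)
Lemma esi_dominated_notin B x y :
  esi e B -> y \in opn e x -> cln e y \subset cln e x -> x \notin B.
Proof.
case/andP => /forall_inP indep /forall_inP supp; rewrite inE => exy sub_yx.
apply/negP => Bx.
have sub_xB : cln e x \subset set_cln e B by apply: (bigcup_sup x).
have yB : y \in set_opn e B.
  rewrite inE (subsetP sub_xB) ?in_cln ?exy ?orbT // andbT.
  by apply/negP => By; move/forall_inP: (indep x Bx) => /(_ y By); rewrite exy.
have /exists_inP[w] := supp y yB; rewrite inE => /negP wB eyw; apply: wB.
by rewrite (subsetP sub_xB) // (subsetP sub_yx) // in_cln eyw orbT.
Qed.

Lemma alpha_es_eq0 : alpha_es e = 0 <-> forall B, esi e B -> B = set0.
Proof.
split=> [a0 B esiB|esi0]; last first.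
  apply/eqP; rewrite -leqn0; apply/bigmax_leqP => B /esi0->.
  by rewrite cards0.
apply/eqP; rewrite -cards_eq0 -leqn0 -a0.
by rewrite /alpha_es (bigmax_sup B).
Qed.

Lemma alpha_es_eq0P :
  alpha_es e = 0 <->
  forall x, exists y, y \in opn e x /\ cln e y \subset cln e x.
Proof.
apply: iff_trans alpha_es_eq0 _; split=> [esi0 x|dom B esiB].
  have : ~~ esi e [set x].
    by apply/negP => /esi0/setP/(_ x); rewrite !inE eqxx.
  rewrite esi1 negb_forall_in => /exists_inP[y xy].
  by rewrite negbK => sub_yx; exists y.
apply/eqP/set0Pn => -[x Bx]; have [y [xy sub_yx]] := dom x.
by move: (esi_dominated_notin esiB xy sub_yx); rewrite Bx.
Qed.

Lemma dominated_twin :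
  (forall x, exists y, y \in opn e x /\ cln e y \subset cln e x) ->
  forall x, exists u, is_twin e u /\ cln e u \subset cln e x.
Proof.
(* Strong induction on the size of N[x]: equality N[y] = N[x] makes [x] itself a twin, and strict
   inclusion lowers the size. *)
move=> dom x; have [n] := ubnP #|cln e x|; elim: n x => // n IHn x le_xn.
have [y [xy sub_yx]] := dom x.
case: (eqVneq (cln e y) (cln e x)) => [eq_yx|neq_yx].
  by exists x; split=> //; exists y; split; first exact: opn_neq.
have lt_yx : #|cln e y| < #|cln e x|.
  by rewrite proper_card // properEneq neq_yx.
have [u [twin_u sub_uy]] := IHn y (leq_trans lt_yx le_xn).
by exists u; split=> //; apply: subset_trans sub_yx.
Qed.

Lemma universal_cln x : universal e x -> cln e x = setT.
Proof.
move=> univ_x; apply/eqP; rewrite eqEcard subsetT cardsT cardsU1 univ_x.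
by rewrite inE e_irr add1n leqSpred.
Qed.

Lemma dominatedP :
  (exists x y, e x y) ->
  (forall x, exists y, y \in opn e x /\ cln e y \subset cln e x) <->
  (forall x, universal e x \/ is_twin e x \/ twin_support e x).
Proof.
move=> [a [b eab]]; split=> [dom x|cases x].
  right; have [y [xy sub_yx]] := dom x.
  case: (eqVneq (cln e y) (cln e x)) => [eq_yx|neq_yx].
    by left; exists y; split; first exact: opn_neq.
  (* Descending from [y] rather than [x] makes the final inclusion in N[x] strict, as a support
     requires. *)
  have [u [twin_u sub_uy]] := dominated_twin dom y.
  right; exists u; split=> //.
  by apply: sub_proper_trans sub_uy _; rewrite properEneq neq_yx.
case: (cases x) => [univ_x|[[y [xy eq_xy]]|[u [_ prop_ux]]]].
- have clnT := universal_cln univ_x.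
  (* A universal vertex dominates every other vertex; the edge between [a] and [b] guarantees that
     another one exists. *)
  have [y xy] : exists y, x <> y.
    case: (eqVneq x a) => [->|/eqP]; last by exists a.
    by exists b; apply: opn_neq; rewrite inE.
  by exists y; rewrite clnT subsetT in_opn_cln // clnT inE.
- by exists y; rewrite eq_xy in_opn_cln // eq_xy cln_refl.
exists u; have sub_ux := proper_sub prop_ux; split=> //.
(* [u] lies in N[u], hence in N[x], and strictness of the inclusion rules out [u = x]. *)
apply: in_opn_cln; last exact: subsetP sub_ux _ (cln_refl u).
by move=> eq_xu; rewrite eq_xu properxx in prop_ux.
Qed.

End Domination.

Theorem theorem10 (T : finType) (e : rel T)
    (e_sym : symmetric e) (e_irr : irreflexive e)
    (has_edge : exists x y : T, e x y) :
  (alpha_es e = 0 <->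
     forall x : T, exists y : T, y \in opn e x /\ cln e y \subset cln e x) /\
  ((forall x : T, exists y : T, y \in opn e x /\ cln e y \subset cln e x) <->
     forall x : T, universal e x \/ is_twin e x \/ twin_support e x).
Proof. by split; [apply: alpha_es_eq0P | apply: dominatedP]. Qed.
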